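(* Let $n\in\mathbb{N}$ and let $\mathbf{s}=(s_0,\ldots,s_n)\subset[0,\infty)$ be positive on $(0,\infty)$. The following are equivalent: (i) $\mathbf{s}$ is strictly positive on $(0,\infty)$; (ii) $\mathrm{ind}_\infty(\mathbf{s})=\left\lceil\frac{n+1}{2}\right\rceil$; (iii) $\mathbf{s}$ is indeterminate on $(0,\infty)$.
   Context: For $a<b$ and $\mathbf{s}=(s_0,\ldots,s_n)$ let $\sigma:\mathbb{R}_n[x]\to\mathbb{R}$ be linear with $\sigma(x^k)=s_k$. $\mathbf{s}$ is positive on $[a,b]$ if $\sigma(P)\ge0$ for every real polynomial $P$ of degree $\le n$ nonnegative on $[a,b]$, and strictly positive on $[a,b]$ if moreover $\sigma(P)>0$ for every such $P$ not identically zero. $\mathbf{s}\subset[0,\infty)$ is positive (resp. strictly positive) on $(0,\infty)$ if it is positive (resp. strictly positive) on some interval $[a,b]\subset(0,\infty)$. $\mathcal{M}_\infty(\mathbf{s})$ denotes the set of positive Borel measures $\mu$ on $(0,\infty)$ with $\mathrm{supp}\,\mu$ contained in some compact $[a,b]\subset(0,\infty)$ and $\int t^kd\mu=s_k$ for $k=0,\ldots,n$; $\mathbf{s}$ is determinate on $(0,\infty)$ if $\mathcal{M}_\infty(\mathbf{s})$ has exactly one element, indeterminate if it has more than one. $\mathrm{ind}_\infty(\mathbf{s})=\min\{\#\mathrm{supp}\,\mu:\mu\in\mathcal{M}_\infty(\mathbf{s})\}$. *)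

(* Defs.v *)
From HB Require Import structures.
From mathcomp Require Import all_boot all_order all_algebra.
From mathcomp Require Import all_classical all_reals all_analysis.
Set Implicit Arguments. Unset Strict Implicit. Unset Printing Implicit Defensive.
Import Order.TTheory GRing.Theory Num.Theory.
Import numFieldNormedType.Exports.
Local Open Scope classical_set_scope.
Local Open Scope ring_scope.

Definition sigma_s (R : realType) (n : nat) (s : 'I_n.+1 -> R) (P : {poly R}) : R :=
  \sum_(k < n.+1) P`_k * s k.

Definition positive_on (R : realType) (n : nat) (s : 'I_n.+1 -> R) (a b : R) : Prop :=
  forall P : {poly R}, (size P <= n.+1)%N ->
    (forall x, a <= x <= b -> 0 <= P.[x]) -> 0 <= sigma_s s P.

Definition strictly_positive_on (R : realType) (n : nat) (s : 'I_n.+1 -> R) (a b : R) : Prop :=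
  positive_on s a b /\
  forall P : {poly R}, (size P <= n.+1)%N ->
    (forall x, a <= x <= b -> 0 <= P.[x]) -> P != 0 -> 0 < sigma_s s P.

Definition positive_pos (R : realType) (n : nat) (s : 'I_n.+1 -> R) : Prop :=
  exists a b : R, 0 < a /\ a < b /\ positive_on s a b.

Definition strictly_positive_pos (R : realType) (n : nat) (s : 'I_n.+1 -> R) : Prop :=
  exists a b : R, 0 < a /\ a < b /\ strictly_positive_on s a b.

Definition open_ball_R (R : realType) (x e : R) : set R := `]x - e, x + e[.

Definition msupp (R : realType) (mu : {measure set R -> \bar R}) : set R :=
  [set x | forall e : R, 0 < e -> (0 < mu (open_ball_R x e))%E].

Definition in_M_oo (R : realType) (n : nat) (s : 'I_n.+1 -> R)
    (mu : {measure set R -> \bar R}) : Prop :=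
  (exists a b : R, 0 < a /\ a < b /\ mu (~` `[a, b]) = 0%E) /\
  forall k : 'I_n.+1, (\int[mu]_x ((x ^+ k)%:E) = (s k)%:E)%E.

Definition determinate_pos (R : realType) (n : nat) (s : 'I_n.+1 -> R) : Prop :=
  (exists mu, in_M_oo s mu) /\
  forall mu nu, in_M_oo s mu -> in_M_oo s nu ->
    forall A, measurable A -> mu A = nu A.

Definition indeterminate_pos (R : realType) (n : nat) (s : 'I_n.+1 -> R) : Prop :=
  exists mu nu, in_M_oo s mu /\ in_M_oo s nu /\
    exists A, measurable A /\ mu A <> nu A.

Definition ind_pos_eq (R : realType) (n : nat) (s : 'I_n.+1 -> R) (m : nat) : Prop :=
  (exists mu, in_M_oo s mu /\ (msupp mu #= `I_m)%card) /\
  forall mu, in_M_oo s mu -> (`I_m #<= msupp mu)%card.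

(* Main.v *)
Require Import Defs.
From HB Require Import structures.
From mathcomp Require Import all_boot all_order all_algebra.
From mathcomp Require Import all_classical all_reals all_analysis.
From mathcomp Require Import lra zify finmap measurable_realfun.
Set Implicit Arguments. Unset Strict Implicit. Unset Printing Implicit Defensive.
Import Order.TTheory GRing.Theory Num.Theory.
Import numFieldNormedType.Exports.
Local Open Scope classical_set_scope.
Local Open Scope ring_scope.

(**
If [s] is strictly positive on [[a, b]], Gauss-type quadrature gives a
representing measure with [uphalf n.+1] atoms: prescribe nodes [e] among the
endpoints with [n.+1 = 2 j + size e], and complete them by the [j] roots of the
orthogonal polynomial of degree [j] for the functional twisted by
[prod_(y in e) (X - y)].  Different choices of [e] ([[::]] against [[:: a; b]],
or [[:: a]] against [[:: b]], according to the parity of [n]) give different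
measures, hence indeterminacy.  Fewer atoms are impossible, since the square of
the nodal polynomial of the support would be a nonzero nonnegative polynomial
with zero integral.

Conversely, if a nonnegative [P] of degree at most [n] has zero integral, every
representing measure lives on the roots of [P].  There are at most [n] of them,
so interpolating indicators on them shows that the measure is unique.  On an
interval containing the support in its interior, the points of the support are
moreover double roots of [P], so there are fewer than [uphalf n.+1] of them.
*)

(** * Nodal polynomials and interpolation *)

Definition nodal (R : nzRingType) (r : seq R) : {poly R} :=
  \prod_(z <- r) ('X - z%:P).

Lemma nodal_cons (R : nzRingType) (c : R) r :
  nodal (c :: r) = ('X - c%:P) * nodal r.
Proof. by rewrite /nodal big_cons. Qed.

Lemma nodal_cat (R : nzRingType) (r t : seq R) :
  nodal (r ++ t) = nodal r * nodal t.
Proof. by rewrite /nodal big_cat. Qed.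

Lemma nodal_rem (R : comNzRingType) (c : R) r :
  c \in r -> nodal r = ('X - c%:P) * nodal (rem c r).
Proof. by move=> cr; rewrite /nodal (perm_big _ (perm_to_rem cr)) big_cons. Qed.

Lemma size_nodal (R : nzRingType) (r : seq R) : size (nodal r) = (size r).+1.
Proof. exact: size_prod_XsubC. Qed.

Lemma monic_nodal (R : nzRingType) (r : seq R) : nodal r \is monic.
Proof. exact: monic_prod_XsubC. Qed.

Lemma nodal_neq0 (R : nzRingType) (r : seq R) : nodal r != 0.
Proof. exact: monic_neq0 (monic_nodal r). Qed.

Lemma nodal_eq0 (R : idomainType) (r : seq R) x :
  ((nodal r).[x] == 0) = (x \in r).
Proof. by rewrite -[LHS]/(root _ _) root_prod_XsubC. Qed.

Lemma nodal_root (R : idomainType) (r : seq R) x :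
  x \in r -> (nodal r).[x] = 0.
Proof. by move=> xr; apply/eqP; rewrite nodal_eq0. Qed.

Lemma interpolation (F : fieldType) (r : seq F) (f : F -> F) : uniq r ->
  exists2 p : {poly F}, (size p <= size r)%N &
    {in r, forall z, p.[z] = f z}.
Proof.
elim: r => [|c r IH] /= => [_|/andP[cr ur]].
  by exists 0; rewrite ?size_poly0.
have [p sp pf] := IH ur.
have rc : (nodal r).[c] != 0 by rewrite nodal_eq0.
(* Newton's form: the correction vanishes at the old nodes and adjusts the value at [c]. *)
exists (p + ((f c - p.[c]) / (nodal r).[c]) *: nodal r).
  rewrite (leq_trans (size_polyD _ _))// geq_max (leq_trans sp)//=.
  by rewrite (leq_trans (size_scale_leq _ _))// size_nodal.
move=> z; rewrite inE hornerD hornerZ => /predU1P[->|zr].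
  by rewrite mulfVK// addrC subrK.
by rewrite (nodal_root zr) (pf _ zr) mulr0 addr0.
Qed.

(** * Polynomials of constant sign on an interval *)

Definition sign_constant (R : numDomainType) (a b : R) (p : {poly R}) :=
  (forall x, a <= x <= b -> 0 <= p.[x]) \/
  (forall x, a <= x <= b -> p.[x] <= 0).

Lemma sign_constantM (R : numDomainType) (a b : R) p q :
  sign_constant a b p -> sign_constant a b q -> sign_constant a b (p * q).
Proof.
move=> [hp|hp] [hq|hq]; [left|right|right|left] => x xab; rewrite hornerM.
- by rewrite mulr_ge0 ?hp ?hq.
- by rewrite mulr_ge0_le0 ?hp ?hq.
- by rewrite mulr_le0_ge0 ?hp ?hq.
- by rewrite mulr_le0 ?hp ?hq.
Qed.

Lemma sign_constant_sqr (R : realDomainType) (a b : R) p :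
  sign_constant a b (p * p).
Proof. by left => x _; rewrite hornerM -expr2 sqr_ge0. Qed.

Lemma sign_constant_nodal (R : realDomainType) (a b : R) r :
  {in r, forall y, y <= a \/ b <= y} -> sign_constant a b (nodal r).
Proof.
elim: r => [_|c r IH H].
  by left => x _; rewrite /nodal big_nil hornerC ler01.
rewrite nodal_cons; apply: sign_constantM; last first.
  by apply: IH => y yr; apply: H; rewrite inE yr orbT.
case: (H c (mem_head _ _)) => hc; [left|right] => x /andP[ax xb];
  rewrite hornerXsubC.
- by rewrite subr_ge0 (le_trans hc).
- by rewrite subr_le0 (le_trans xb).
Qed.

Lemma poly_sign_change_root (R : rcfType) (a b : R) (p : {poly R}) :
  ~ sign_constant a b p -> exists2 c, a < c < b & root p c.
Proof.
move=> /not_orP[/existsNP[x /not_implyP[/andP[ax xb] /negP]]].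
rewrite -ltNge => px /existsNP[y /not_implyP[/andP[ay yb] /negP]].
rewrite -ltNge => py.
have [xy|yx] := leP x y.
  have [|c /andP[xc cy] rc] := @poly_ivt _ p x y xy.
    by rewrite !ltW.
  (* [p] is nonzero at [x] and [y], so the root differs from both and is interior even when these
     are the endpoints. *)
  exists c => //; rewrite (le_lt_trans ax) ?(lt_le_trans _ yb)//.
  - rewrite lt_neqAle cy andbT; apply/eqP => E.
    by move: rc; rewrite E /root gt_eqF.
  - rewrite lt_neqAle xc andbT; apply/eqP => E.
    by move: rc; rewrite -E /root lt_eqF.
have [|c /andP[yc cx]] := @poly_ivt _ (- p) y x (ltW yx).
  by rewrite !hornerN oppr_le0 oppr_ge0 !ltW.
rewrite rootN => rc.
exists c => //; rewrite (le_lt_trans ay) ?(lt_le_trans _ xb)//.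
- rewrite lt_neqAle cx andbT; apply/eqP => E.
  by move: rc; rewrite E /root lt_eqF.
- rewrite lt_neqAle yc andbT; apply/eqP => E.
  by move: rc; rewrite -E /root gt_eqF.
Qed.

(* The list produced is that of the roots of odd multiplicity in ]a, b[. *)
Lemma sign_constant_mul_nodal (R : rcfType) (a b : R) (p : {poly R}) : p != 0 ->
  exists r, [/\ uniq r, {in r, forall z, a < z < b}, all (root p) r &
    sign_constant a b (p * nodal r)].
Proof.
have [k] := ubnP (size p); elim: k p => // k IH p sp p0.
have [|/poly_sign_change_root[c cab]] := pselect (sign_constant a b p).
  by exists [::]; split=> //; rewrite /nodal big_nil mulr1.
move=> /factor_theorem[q pE]; rewrite {}pE in sp p0 *.
have q0 : q != 0 by apply: contraNneq p0 => ->; rewrite mul0r.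
have [|r [ur rab rr sc]] := IH q _ q0.
  by move: sp; rewrite size_Mmonic ?monicXsubC// size_XsubC addn2.
have rootq z : root q z -> root (q * ('X - c%:P)) z.
  by move=> qz; rewrite rootM qz.
(* The extra factor at [c] flips the parity of its multiplicity, so [c] leaves the list if it was
   there and enters it otherwise. In the second case the product gains the square of ['X - c%:P]. *)
have [cr|cr] := boolP (c \in r).
  exists (rem c r); split; first exact: rem_uniq.
  - by move=> z /mem_rem /rab.
  - by apply/allP => z /mem_rem zr; apply/rootq/(allP rr).
  - by rewrite -mulrA -nodal_rem.
exists (c :: r); split; first by rewrite /= cr.
- by move=> z; rewrite inE => /predU1P[->|/rab].
- rewrite /= rootM root_XsubC eqxx orbT /=.
  by apply/allP => z zr; apply/rootq/(allP rr).
- rewrite nodal_cons mulrA -[X in X * _]mulrA mulrAC.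
  by apply: sign_constantM => //; exact: sign_constant_sqr.
Qed.

(** * Orthogonal polynomials and quadrature rules *)

Lemma orthogonal_poly (F : fieldType) (L : {scalar {poly F}}) (E : {poly F}) k :
  (forall q : {poly F}, q != 0 -> (size q <= k)%N -> L (E * (q * q)) != 0) ->
  exists p : {poly F}, [/\ p \is monic, size p = k.+1 &
    forall q : {poly F}, (size q <= k)%N -> L (E * p * q) = 0].
Proof.
move=> defE.
(* Gram matrix of the monomials for the form sending [p], [q] to [L (E * p * q)]. *)
pose M : 'M[F]_k := \matrix_(i, j) L (E * 'X^(i + j)).
have rVE (u : 'rV[F]_k) : rVpoly u = \sum_(i < k) u 0 i *: 'X^i.
  rewrite [in LHS](row_sum_delta u) linear_sum/=; apply: eq_bigr => i _.
  by rewrite linearZ /= rVpoly_delta.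
have LM (u : 'rV[F]_k) (j : 'I_k) : L (E * rVpoly u * 'X^j) = (u *m M) 0 j.
  rewrite rVE mulr_sumr mulr_suml linear_sum mxE; apply: eq_bigr => i _.
  by rewrite -scalerAr -scalerAl linearZ /= mxE -mulrA -exprD.
have Lq (p q : {poly F}) : (size q <= k)%N ->
    (forall j : 'I_k, L (E * p * 'X^j) = 0) -> L (E * p * q) = 0.
  move=> sq H; rewrite -(poly_rV_K sq) rVE mulr_sumr linear_sum big1// => j _.
  by rewrite -scalerAr linearZ /= H mulr0.
(* A nonzero kernel vector would be a polynomial [q] with [L (E * (q * q)) = 0], against the
   hypothesis. *)
have uM : M \in unitmx.
  rewrite -row_free_unit; apply/inj_row_free => u uM0; apply/eqP.
  rewrite -(inj_eq (can_inj rVpolyK)) linear0; apply/negPn/negP => u0.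
  have su : (size (rVpoly u) <= k)%N by exact: size_poly.
  move: (defE _ u0 su); rewrite mulrA Lq ?eqxx// => j.
  by rewrite LM uM0 mxE.
(* The lower coefficients solve the linear system making ['X^k + rVpoly u] orthogonal to each
   ['X^j], [j < k]. *)
pose u := - (\row_j L (E * 'X^k * 'X^j)) *m invmx M.
have su : (size (rVpoly u) < size ('X^k : {poly F}))%N.
  by rewrite size_polyXn ltnS size_poly.
exists ('X^k + rVpoly u); split.
- by rewrite monicE lead_coefDl// lead_coefXn.
- by rewrite size_polyDl// size_polyXn.
move=> q sq; apply: Lq => // j.
by rewrite mulrDr mulrDl linearD /= LM /u mulmxKV// !mxE subrr.
Qed.

Definition strictly_positive_fun (R : numDomainType) (L : {poly R} -> R)
    (N : nat) (a b : R) :=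
  forall P : {poly R}, (size P <= N)%N ->
    (forall x, a <= x <= b -> 0 <= P.[x]) -> P != 0 -> 0 < L P.

(** Meant for a test polynomial vanishing at every node of a rule except [x]: strict positivity
    gives [L T] the sign of [T] on the interval and excludes [T.[x] = 0]. *)
Lemma sign_constant_weight (R : realDomainType) (L : {scalar {poly R}}) N
    (a b x w : R) (T : {poly R}) : strictly_positive_fun L N a b ->
  (size T <= N)%N -> T != 0 -> sign_constant a b T ->
  a <= x <= b -> L T = w * T.[x] -> 0 < w.
Proof.
move=> Lpos sT T0 [Tp|Tp] xab LT.
  have := Lpos _ sT Tp T0; rewrite LT pmulr_lgt0// lt_neqAle Tp// andbT eq_sym.
  apply/eqP => T0x; move: (Lpos _ sT Tp T0).
  by rewrite LT T0x mulr0 ltxx.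
have LN : 0 < L (- T).
  apply: Lpos; rewrite ?size_polyN ?oppr_eq0// => y yab.
  by rewrite hornerN oppr_ge0 Tp.
move: (LN); rewrite linearN /= oppr_gt0 LT nmulr_llt0// lt_neqAle Tp// andbT.
by apply/eqP => T0x; move: LN; rewrite linearN/= LT T0x mulr0 oppr0 ltxx.
Qed.

Lemma sign_constant_neq0 (R : realDomainType) (L : {scalar {poly R}}) N
    (a b : R) (T : {poly R}) : strictly_positive_fun L N a b ->
  (size T <= N)%N -> T != 0 -> sign_constant a b T -> L T != 0.
Proof.
move=> Lpos sT T0 [Tp|Tp]; first by rewrite gt_eqF// Lpos.
rewrite -oppr_eq0 -(linearN L) gt_eqF// Lpos ?size_polyN ?oppr_eq0// => y yab.
by rewrite hornerN oppr_ge0 Tp.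
Qed.

(* Gauss (e = [::]), Radau (e = [:: a]) and Lobatto (e = [:: a; b]) rules. *)
Lemma quadrature (R : rcfType) (L : {scalar {poly R}}) (N j : nat) (a b : R) e :
  a < b -> strictly_positive_fun L N a b -> N = (j.*2 + size e)%N ->
  uniq e -> {in e, forall y, y = a \/ y = b} ->
  exists r (w : R -> R), [/\ uniq (e ++ r), size r = j,
    {in r, forall z, a < z < b}, {in e ++ r, forall x, 0 < w x} &
    forall P : {poly R}, (size P <= N)%N ->
      L P = \sum_(x <- e ++ r) w x * P.[x]].
Proof.
move=> ab Lpos NE ue eab.
have sce : sign_constant a b (nodal e).
  by apply: sign_constant_nodal => y /eab[->|->]; [left|right].
have [p [mp sp Lp]] : exists p : {poly R}, [/\ p \is monic, size p = j.+1 &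
    forall q : {poly R}, (size q <= j)%N -> L (nodal e * p * q) = 0].
  apply: orthogonal_poly => q q0 sq.
  have qq0 : q * q != 0 by rewrite mulf_neq0.
  apply: (sign_constant_neq0 Lpos).
  - rewrite size_monicM ?monic_nodal// size_nodal size_mul// NE.
    by move: sq; move: (size q) (size e) => ? ? ?; lia.
  - by rewrite mulf_neq0 ?nodal_neq0.
  - by apply: sign_constantM => //; exact: sign_constant_sqr.
have [r [ur rab rr scr]] := sign_constant_mul_nodal a b (monic_neq0 mp).
(* With fewer than [j] sign changes, [nodal e * p * nodal r] has constant sign and admissible size,
   yet orthogonality makes [L] vanish on it. *)
have srj : size r = j.
  have := max_poly_roots (monic_neq0 mp) rr ur.
  rewrite sp ltnS leq_eqVlt => /predU1P[//|srj].
  have : L (nodal e * (p * nodal r)) != 0.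
    apply: (sign_constant_neq0 Lpos).
    - rewrite size_monicM ?monic_nodal ?mulf_neq0 ?nodal_neq0 ?monic_neq0//.
      rewrite size_monicM ?nodal_neq0// !size_nodal sp NE; move: srj.
      by move: (size r) (size e) => ? ? ?; lia.
    - by rewrite !mulf_neq0 ?nodal_neq0 ?monic_neq0.
    - exact: sign_constantM.
  by rewrite mulrA Lp ?eqxx// size_nodal.
have pE : p = nodal r.
  have := all_roots_prod_XsubC _ rr _.
  rewrite sp srj uniq_rootsE => /(_ erefl ur) ->.
  by rewrite (monicP mp) scale1r.
have ner z : z \in e -> z \notin r.
  move=> /eab ze; apply/negP => /rab /andP[az zb].
  by case: ze => E; rewrite E ltxx in az zb.
have ut : uniq (e ++ r).
  rewrite cat_uniq ue ur andbT /=; apply/hasPn => z zr /=.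
  by apply: contraTN zr; exact: ner.
(* Lagrange basis at the nodes; the weights are the values of [L] on it. *)
have /choice[ell ellP] : forall x : R, exists q : {poly R},
    (size q <= size (e ++ r))%N /\ {in e ++ r, forall z, q.[z] = (z == x)%:R}.
  by move=> x; have [q] := interpolation (fun z => (z == x)%:R) ut; exists q.
pose w x := L (ell x).
have LE (P : {poly R}) : (size P <= N)%N ->
    L P = \sum_(x <- e ++ r) w x * P.[x].
  move=> sP.
  (* Gauss's argument: the quotient by [t] has size at most [j], so [L (q * t) = 0] by
     orthogonality, and the remainder equals its Lagrange interpolant. *)
  pose t := nodal (e ++ r); pose q := P %/ t; pose m := P %% t.
  have PE : P = q * t + m by exact: divp_eq.
  have PEx x : x \in e ++ r -> P.[x] = m.[x].
    by move=> xt; rewrite PE hornerD hornerM nodal_root// mulr0 add0r.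
  have -> : L P = L m.
    rewrite PE linearD /= /t nodal_cat mulrC -pE Lp ?add0r//.
    rewrite /q size_divp ?nodal_neq0// size_nodal /= size_cat srj.
    by move: sP; rewrite NE; move: (size P) (size e) => ? ? ?; lia.
  have -> : m = \sum_(x <- e ++ r) m.[x] *: ell x.
    apply/eqP; rewrite -subr_eq0; apply/eqP.
    apply: (roots_geq_poly_eq0 _ ut).
      apply/allP => z zt; rewrite /root hornerD hornerN horner_sum.
      rewrite (bigD1_seq z)//= hornerZ (ellP z).2// eqxx mulr1.
      rewrite big1_seq ?addr0 ?subrr// => x /andP[xz xt].
      by rewrite hornerZ (ellP x).2// eq_sym (negbTE xz) mulr0.
    rewrite (leq_trans (size_polyD _ _))// geq_max; apply/andP; split.
      have := ltn_modp P t; rewrite nodal_neq0 /t size_nodal ltnS.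
      by move=> ->.
    rewrite size_polyN; apply: (leq_trans (size_sum _ _ _)).
    apply/bigmax_leqP_seq => x xt _.
    by rewrite (leq_trans (size_scale_leq _ _))// (ellP x).1.
  rewrite linear_sum; apply: eq_big_seq => x xt.
  by rewrite linearZ /= PEx// mulrC -/(w x).
exists r, w; split=> // x xt.
have wT (T : {poly R}) : (size T <= N)%N -> T != 0 -> sign_constant a b T ->
    {in e ++ r, forall z, z != x -> T.[z] = 0} -> 0 < w x.
  move=> sT T0 scT Tz.
  apply: (sign_constant_weight (x := x) Lpos sT) => //.
    move: xt; rewrite mem_cat => /orP[/eab[]->|/rab/andP[? ?]];
    by rewrite ?lexx ?ltW.
  rewrite LE// (bigD1_seq x)//= big1_seq ?addr0// => z /andP[zx zt].
  by rewrite Tz// mulr0.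
move: (xt); rewrite mem_cat => /orP[xe|xr].
(* At an endpoint, dropping one factor of [nodal e] leaves room to square all of [nodal r]: the size
   is exactly [N]. *)
- apply: (wT (nodal (rem x e) * (nodal r * nodal r))).
  + have: (0 < size e)%N by case: (e) xe.
    rewrite !(size_monicM, size_nodal, size_rem, monic_nodal, mulf_neq0,
      nodal_neq0)//.
    by rewrite srj NE; move: (size e) => ?; lia.
  + by rewrite !mulf_neq0 ?nodal_neq0.
  + apply: sign_constantM; last exact: sign_constant_sqr.
    by apply: sign_constant_nodal => y /mem_rem /eab[->|->]; [left|right].
  + move=> z; rewrite mem_cat => /orP[ze|zr] zx; rewrite !hornerM.
      by rewrite [X in X * _]nodal_root ?mul0r// mem_rem_uniq// !inE zx.
    by rewrite [X in _ * (_ * X)]nodal_root// !mulr0.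
(* At an interior node, [x] is removed from both copies of [r], which keeps a square. *)
- apply: (wT (nodal e * (nodal (rem x r) * nodal (rem x r)))).
  + have: (0 < size r)%N by case: (r) xr.
    rewrite !(size_monicM, size_nodal, size_rem, monic_nodal, mulf_neq0,
      nodal_neq0)//.
    by rewrite srj NE; move: (size e) => ?; lia.
  + by rewrite !mulf_neq0 ?nodal_neq0.
  + by apply: sign_constantM => //; exact: sign_constant_sqr.
  + move=> z; rewrite mem_cat => /orP[ze|zr] zx; rewrite !hornerM.
      by rewrite [X in X * _]nodal_root ?mul0r.
    by rewrite [X in _ * (_ * X)]nodal_root ?mulr0// mem_rem_uniq// !inE zx.
Qed.

(** * Root counts and finite sets *)

Lemma nonneg_double_roots (R : realType) (a b : R) (P : {poly R}) r : P != 0 ->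
  (forall x, a <= x <= b -> 0 <= P.[x]) -> uniq r ->
  {in r, forall z, a < z < b} -> all (root P) r -> ((size r).*2 < size P)%N.
Proof.
move=> P0 Ppos ur rab rr.
have := uniq_roots_dvdp rr; rewrite uniq_rootsE => /(_ ur) /dvdpP[Q].
rewrite -/(nodal r) => PE.
have Q0 : Q != 0 by apply: contraNneq P0 => Q0; rewrite PE Q0 mul0r.
(* Each [z] in [r] is an interior minimum of [P], so the derivative vanishes there; since [z] is a
   simple root of [nodal r], it must be a root of the cofactor [Q] too. *)
have : (size r < size Q)%N.
  apply: max_poly_roots => //; apply/allP => z zr.
  have /andP[az zb] := rab _ zr.
  have dP : is_derive z (1 : R) (horner P) 0.
    apply: (@derive1_at_min _ _ a b).
    - exact: ltW (lt_trans az zb).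
    - by move=> t _; exact: derivable_horner.
    - by rewrite in_itv /= az.
    - move=> t; rewrite in_itv /= => /andP[/ltW at_ /ltW tb].
      by rewrite (eqP (allP rr _ zr)) Ppos// at_.
  have : P^`().[z] = 0.
    have [_ <-] := dP; have [_ <-] := is_derive_poly P z; done.
  rewrite PE (nodal_rem zr) mulrCA derivM derivXsubC mul1r hornerD !hornerM.
  rewrite hornerXsubC subrr mul0r addr0 => /eqP; rewrite mulf_eq0.
  rewrite nodal_eq0 mem_rem_uniq// !inE eqxx /= orbF.
  by [].
rewrite PE size_Mmonic ?monic_nodal// size_nodal.
by move: (size r) (size Q) => ? ?; lia.
Qed.

Lemma poly_all_roots (F : idomainType) (p : {poly F}) : p != 0 ->
  exists r, [/\ uniq r, (size r < size p)%N & forall z, root p z -> z \in r].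
Proof.
move=> p0; suff [r [ur rr H]] :
    exists r, [/\ uniq r, all (root p) r & forall z, root p z -> z \in r].
  by exists r; split=> //; exact: max_poly_roots.
have [k] := ubnP (size p); elim: k p p0 => // k IH p p0 sp.
have [[c /[dup] rc /factor_theorem[q pE]]|nor] := pselect (exists c, root p c);
  last by exists [::]; split=> // z rz; case: nor; exists z.
have q0 : q != 0 by apply: contraNneq p0 => q0; rewrite pE q0 mul0r.
have [|r [ur rr H]] := IH _ q0.
  by move: sp; rewrite pE size_Mmonic ?monicXsubC// size_XsubC addn2.
exists (undup (c :: r)); split; first exact: undup_uniq.
- apply/allP => z; rewrite mem_undup inE => /predU1P[->//|/(allP rr) qz].
  by rewrite pE rootM qz.
- move=> z; rewrite mem_undup inE pE rootM root_XsubC orbC.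
  by move=> /orP[->//|/H ->]; rewrite orbT.
Qed.

Lemma card_eq_seq (T : choiceType) (t : seq T) :
  uniq t -> ([set` t] #= `I_(size t))%card.
Proof.
move=> ut; have -> : [set` t] = [set` [fset x in t]%fset].
  by apply/seteqP; split => x /=; rewrite inE.
by apply/card_eq_fsetP; rewrite card_fseq undup_id.
Qed.

Lemma card_eq_uniq_seq (T : choiceType) (A : set T) m : (A #= `I_m)%card ->
  exists r, [/\ uniq r, size r = m & A = [set` r]].
Proof.
move=> Am; have fA : finite_set A by apply/finite_setP; exists m.
exists (fset_set A); split; [exact: fset_uniq|exact: card_fset_set|].
by rewrite fset_setK.
Qed.

(** * Integrals of polynomials and supports of measures *)

Lemma measurable_poly_neq0 (R : realType) (P : {poly R}) :
  measurable [set x | P.[x] != 0].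
Proof.
have := @measurable_poly R P setT measurableT _
  (measurableC (measurable_set1 0)).
rewrite setTI; congr measurable; apply/seteqP; split => x /=.
  by move/eqP.
by move=> /eqP.
Qed.

Lemma emeasurable_poly (R : realType) (P : {poly R}) (D : set R) :
  measurable_fun D (EFin \o horner P).
Proof. by apply/measurable_EFinP; exact: measurable_poly. Qed.

Lemma ae_eq_off (R : realType) (mu : {measure set R -> \bar R})
    (A : set R) (f g : R -> \bar R) : measurable A -> mu A = 0%E ->
  (forall x, ~ A x -> f x = g x) -> ae_eq mu setT f g.
Proof.
move=> mA A0 fg; exists A; split=> // x /= fgx; apply: contrapT => Ax.
by apply: fgx => _; exact: fg.
Qed.

(** [P] may be negative only on a null set; the absolute value gives access to the facts on
    nonnegative integrands. *)
Lemma integral_poly_abs (R : realType) (mu : {measure set R -> \bar R})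
    (a : R) (b : R) (P : {poly R}) : mu (~` `[a, b]) = 0%E ->
  (forall x, a <= x <= b -> 0 <= P.[x]) ->
  (\int[mu]_x (P.[x])%:E = \int[mu]_x `|(P.[x])%:E|)%E.
Proof.
move=> mab Ppos; apply: ae_eq_integral => //.
- exact: emeasurable_poly.
- by apply: measurableT_comp => //; exact: emeasurable_poly.
- apply: (ae_eq_off (A := ~` `[a, b])) => //; first exact: measurableC.
  by move=> x /contrapT; rewrite /= in_itv /= => /Ppos h; rewrite ger0_norm.
Qed.

Lemma integral_poly_eq0 (R : realType) (mu : {measure set R -> \bar R})
    (a : R) (b : R) (P : {poly R}) : mu (~` `[a, b]) = 0%E ->
  (forall x, a <= x <= b -> 0 <= P.[x]) ->
  (\int[mu]_x (P.[x])%:E = 0)%E -> mu [set x | P.[x] != 0] = 0%E.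
Proof.
move=> mab Ppos; rewrite (integral_poly_abs mab)//.
move=> /(ae_eq_integral_abs mu measurableT (@emeasurable_poly R P setT)) H.
apply/negligibleP; first exact: measurable_poly_neq0.
apply: negligibleS H => x /= /eqP Px H; apply: Px.
by have := H I; case.
Qed.

(** By continuity, a point where [P] is nonzero has a ball inside the null set. *)
Lemma msupp_root (R : realType) (mu : {measure set R -> \bar R})
    (P : {poly R}) (x : R) : mu [set x | P.[x] != 0] = 0%E -> msupp mu x ->
  root P x.
Proof.
move=> mP sx; apply/negPn/negP => Px.
have /nbhs_ballP[e /= e0 xe] : \forall y \near x, P.[y] != 0.
  have := @continuous_horner R P x; move=> /cvgr_neq0; apply=> //.
have := sx _ e0; rewrite (_ : mu _ = 0%E) ?ltxx//.
apply: subset_measure0 mP; [exact: measurable_itv|exact: measurable_poly_neq0|].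
move=> y; rewrite /open_ball_R /= in_itv /= => /andP[h1 h2]; apply: xe => /=.
by rewrite /ball /= ltr_norml; lra.
Qed.

Lemma msupp_itv (R : realType) (mu : {measure set R -> \bar R}) (a : R)
    (b : R) (x : R) : mu (~` `[a, b]) = 0%E -> msupp mu x -> a <= x <= b.
Proof.
move=> mab sx; apply/negPn/negP; rewrite negb_and -!ltNge => xab.
have [e e0 H] : exists2 e, 0 < e & open_ball_R x e `<=` ~` `[a, b].
  case/orP: xab => h; [exists (a - x)|exists (x - b)]; rewrite ?subr_gt0//;
  by move=> y; rewrite /open_ball_R /= !in_itv /=; lra.
have := sx _ e0; rewrite (_ : mu _ = 0%E) ?ltxx//.
apply: subset_measure0 mab => //; [exact: measurable_itv|exact: measurableC].
Qed.

(** A point off the support has a null ball, hence a null interval with rational endpoints around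
    it; there are countably many of these. *)
Lemma negligible_setC_msupp (R : realType) (mu : {measure set R -> \bar R}) :
  mu.-negligible (~` msupp mu).
Proof.
pose I (pq : rat * rat) : set R := `]ratr pq.1, ratr pq.2[%classic.
(* Enumeration of the null rational intervals; codes of anything else contribute [set0]. *)
pose F k := if choice.unpickle k is Some pq
  then if mu (I pq) == 0%E then I pq else set0 else set0.
have : mu.-negligible (\bigcup_k F k).
  apply: negligible_bigcup => k; rewrite /F; case: choice.unpickle => [pq|];
    last exact: negligible_set0.
  case: eqP => [pq0|_]; last exact: negligible_set0.
  by apply/negligibleP => //; exact: measurable_itv.
apply: negligibleS => x /= /existsNP[e /not_implyP[e0 /negP]].
rewrite -leNgt measure_le0 => /eqP me.
have [p] : exists p : rat, ratr p \in `]x - e, x[.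
  by apply: rat_in_itvoo; lra.
have [q] : exists q : rat, ratr q \in `]x, x + e[.
  by apply: rat_in_itvoo; lra.
rewrite !in_itv /= => hq hp.
have I0 : mu (I (p, q)) = 0%E.
  apply: subset_measure0 me; try exact: measurable_itv.
  by move=> y; rewrite /I /open_ball_R !set_itvE /=; lra.
have FE : F (choice.pickle (p, q)) = I (p, q).
  by rewrite /F choice.pickleK I0 eqxx.
exists (choice.pickle (p, q)); first exact: Logic.I.
by rewrite FE /I set_itvE /=; lra.
Qed.

(** * Finitely atomic measures *)

Definition atomic_measure (R : realType) (t : seq R) (w : R -> R) :
  {measure set R -> \bar R} :=
  msum (fun i => mscale `|w t`_i|%:nng \d_(t`_i)) (size t).

Lemma atomic_measureE (R : realType) (t : seq R) (w : R -> R) (A : set R) :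
  atomic_measure t w A =
  (\sum_(x <- t) (`|w x|)%:E * \d_x A)%E.
Proof. by rewrite (big_nth 0) big_mkord. Qed.

Lemma integral_atomic (R : realType) (t : seq R) (w : R -> R) (f : R -> R) :
  measurable_fun setT f ->
  (\int[atomic_measure t w]_x (f x)%:E = (\sum_(x <- t) `|w x| * f x)%:E)%E.
Proof.
move=> mf.
(* Nonnegative integrands first; the general case follows from the positive and negative parts. *)
have ge0 (g : R -> R) : measurable_fun setT g -> (forall x, 0 <= g x) ->
    (\int[atomic_measure t w]_x (g x)%:E = (\sum_(x <- t) `|w x| * g x)%:E)%E.
  move=> mg g0; rewrite ge0_integral_measure_sum//; last 2 first.
  - by move=> x _; rewrite lee_fin.
  - exact/measurable_EFinP.
  rewrite -sumEFin (big_nth 0) big_mkord; apply: eq_bigr => i _.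
  rewrite ge0_integral_mscale//; last 2 first.
  - exact/measurable_EFinP.
  - by move=> x _; rewrite lee_fin.
  rewrite integral_dirac//; last exact/measurable_EFinP.
  by rewrite diracE in_setT mul1e EFinM.
rewrite integralE.
under eq_integral do rewrite funeposE -EFin_max.
under [X in (_ - X)%E]eq_integral do rewrite funenegE -EFinN -EFin_max.
rewrite !ge0; last 4 first.
- by apply: measurable_maxr => //; exact: measurableT_comp.
- by move=> x; rewrite le_max lexx orbT.
- exact: measurable_maxr.
- by move=> x; rewrite le_max lexx orbT.
rewrite -EFinB -sumrB; congr EFin; apply: eq_bigr => x _.
rewrite -mulrBr; congr (_ * _).
by case: (leP (f x) 0); case: (leP (- f x) 0); lra.
Qed.

Lemma msupp_atomic (R : realType) (t : seq R) (w : R -> R) :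
  {in t, forall x, 0 < w x} -> msupp (atomic_measure t w) = [set` t].
Proof.
move=> w0; apply/seteqP; split => x /= xs.
  (* [nodal t] vanishes exactly at the atoms, so the set where it is nonzero is null. *)
  have : root (nodal t) x.
    apply: msupp_root xs; rewrite atomic_measureE big1_seq// => z /= zt.
    by rewrite diracE memNset /= ?nodal_root ?eqxx// mule0.
  by rewrite root_prod_XsubC.
move=> e e0; rewrite atomic_measureE (big_rem x)//=.
rewrite lte_paddr//; first by apply: sume_ge0 => z _; rewrite mule_ge0.
rewrite diracE mem_set; first by rewrite mule1 lte_fin normr_gt0 gt_eqF ?w0.
by rewrite /open_ball_R set_itvE /=; lra.
Qed.

(** * The moment functional and representing measures *)

Lemma sigma_s_is_scalar (R : realType) (n : nat) (s : 'I_n.+1 -> R) :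
  scalar (sigma_s s).
Proof.
move=> c p q; rewrite /sigma_s mulr_sumr -big_split /=; apply: eq_bigr => k _.
by rewrite coefD coefZ mulrDl mulrA.
Qed.

HB.instance Definition _ (R : realType) (n : nat) (s : 'I_n.+1 -> R) :=
  GRing.isLinear.Build R {poly R} R *%R (sigma_s s) (sigma_s_is_scalar s).

Lemma sigma_sXn (R : realType) (n : nat) (s : 'I_n.+1 -> R) (k : 'I_n.+1) :
  sigma_s s 'X^k = s k.
Proof.
rewrite /sigma_s (bigD1 k)//= coefXn eqxx mul1r big1 ?addr0// => i ik.
by rewrite coefXn -[_ == _]/(i == k) (negbTE ik) mul0r.
Qed.

Lemma integral_in_M_oo (R : realType) (n : nat) (s : 'I_n.+1 -> R)
    (mu : {measure set R -> \bar R}) (P : {poly R}) :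
  in_M_oo s mu -> (size P <= n.+1)%N ->
  (\int[mu]_x (P.[x])%:E = (sigma_s s P)%:E)%E.
Proof.
move=> [_ mus] sP.
(* A measurable function with finite integral is integrable, so the prescribed moments suffice. *)
have ix (k : 'I_n.+1) : mu.-integrable setT (fun x : R => (x ^+ k)%:E).
  have mx : measurable_fun setT (fun x : R => x ^+ k).
    exact: exprn_measurable.
  apply/integrableP; split; first exact/measurable_EFinP.
  by rewrite integral_fin_num_abs// mus.
under eq_integral => x _.
  rewrite (horner_coef_wide _ sP) -sumEFin.
  under eq_bigr do rewrite EFinM.
  over.
rewrite integral_sum//=; last by move=> k; exact: integrableZl.
rewrite /sigma_s -sumEFin; apply: eq_bigr => k _.
by rewrite integralZl// mus EFinM.
Qed.

Lemma measure_setC_itv0_le (R : realType) (mu : {measure set R -> \bar R})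
    (a b c d : R) :
  mu (~` `[a, b]) = 0%E -> c <= a -> b <= d -> mu (~` `[c, d]) = 0%E.
Proof.
move=> mab ca bd; apply: subset_measure0 mab; try exact: measurableC.
by apply: subsetC => x; rewrite !set_itvE /=; lra.
Qed.

Lemma in_M_oo_positive_on (R : realType) (n : nat) (s : 'I_n.+1 -> R)
    (mu : {measure set R -> \bar R}) (a b : R) :
  in_M_oo s mu -> mu (~` `[a, b]) = 0%E -> positive_on s a b.
Proof.
move=> Mmu mab P sP Ppos; rewrite -lee_fin -(integral_in_M_oo Mmu)//.
by rewrite (integral_poly_abs mab)// integral_ge0.
Qed.

Lemma in_M_oo_off_root (R : realType) (n : nat) (s : 'I_n.+1 -> R)
    (mu : {measure set R -> \bar R}) (a b : R) (P : {poly R}) :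
  in_M_oo s mu -> mu (~` `[a, b]) = 0%E -> (size P <= n.+1)%N ->
  (forall x, a <= x <= b -> 0 <= P.[x]) -> sigma_s s P = 0 ->
  mu [set x | P.[x] != 0] = 0%E.
Proof.
move=> Mmu mab sP Ppos P0; apply: (integral_poly_eq0 mab Ppos).
by rewrite (integral_in_M_oo Mmu)// P0.
Qed.

Lemma strictly_positive_onP (R : realType) (n : nat) (s : 'I_n.+1 -> R)
    (a b : R) : positive_on s a b ->
  (forall P : {poly R}, (size P <= n.+1)%N ->
    (forall x, a <= x <= b -> 0 <= P.[x]) -> sigma_s s P = 0 -> P = 0) ->
  strictly_positive_on s a b.
Proof.
move=> pos H; split=> // P sP Ppos P0; rewrite lt_neqAle pos// andbT eq_sym.
by apply: contraNneq P0 => /H ->.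
Qed.

(** * The implications between strict positivity, index and indeterminacy *)

Lemma indeterminate_strictly_positive (R : realType) (n : nat)
    (s : 'I_n.+1 -> R) : indeterminate_pos s -> strictly_positive_pos s.
Proof.
move=> [mu [nu [Mmu [Mnu [A [mA muA]]]]]].
have [[a [b [a0 [ab muab]]]] _] := Mmu.
have [[c [d [c0 [cd nucd]]]] _] := Mnu.
(* One interval carrying both measures, so that a single [P] constrains them together. *)
pose e := Num.min a c; pose f := Num.max b d.
have mue : mu (~` `[e, f]) = 0%E.
  by apply: measure_setC_itv0_le muab _ _; rewrite ?ge_min ?le_max lexx.
have nue : nu (~` `[e, f]) = 0%E.
  by apply: measure_setC_itv0_le nucd _ _; rewrite ?ge_min ?le_max lexx orbT.
exists e, f; split; first by rewrite lt_min a0.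
split; first by rewrite /e /f gt_min !lt_max ab.
apply: strictly_positive_onP; first exact: (in_M_oo_positive_on Mmu).
move=> P sP Ppos sP0; apply/eqP/negPn/negP => P0; apply: muA.
have [r [ur rP rr]] := poly_all_roots P0.
have [L sL LA] := interpolation (fun z => \1_A z : R) ur.
have sL' : (size L <= n.+1)%N.
  by rewrite (leq_trans sL)// ltnW// (leq_trans rP).
(* Both measures live on the roots of [P], where [L] agrees with the indicator of [A]; so [s] alone
   determines their value on [A]. *)
have key nu' : in_M_oo s nu' -> nu' (~` `[e, f]) = 0%E ->
    nu' A = (sigma_s s L)%:E.
  move=> M' ne; rewrite -(integral_in_M_oo M')// -[A in LHS]setIT.
  rewrite -integral_indic//; apply: ae_eq_integral => //.
  - by apply/measurable_EFinP; exact: measurable_indic.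
  - exact: emeasurable_poly.
  - apply: (ae_eq_off (A := [set x | P.[x] != 0])).
    + exact: measurable_poly_neq0.
    + exact: (in_M_oo_off_root M' ne).
    + by move=> x /negP; rewrite negbK => /rr /LA ->.
by rewrite key ?key.
Qed.

Lemma ind_strictly_positive (R : realType) (n : nat)
    (s : 'I_n.+1 -> R) : ind_pos_eq s (uphalf n.+1) -> strictly_positive_pos s.
Proof.
move=> [[mu [Mmu /card_eq_uniq_seq[r [ur sr murE]]]] _].
have [[a [b [a0 [ab muab]]]] _] := Mmu.
(* The enlargement puts the support in the interior, as double roots require, and keeps the left end
   positive. *)
have mue : mu (~` `[a / 2, b + 1]) = 0%E.
  by apply: measure_setC_itv0_le muab _ _; lra.
exists (a / 2), (b + 1); split; first lra.
split; first lra.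
apply: strictly_positive_onP; first exact: (in_M_oo_positive_on Mmu).
move=> P sP Ppos sP0; apply/eqP/negPn/negP => P0.
have memr z : z \in r -> msupp mu z by rewrite murE.
have : ((size r).*2 < size P)%N.
  apply: (nonneg_double_roots P0 Ppos ur).
  - by move=> z /memr /(msupp_itv muab); lra.
  - apply/allP => z /memr; apply: msupp_root.
    exact: (in_M_oo_off_root Mmu mue).
(* Twice [uphalf n.+1] is at least [n.+1], whereas the root count makes it smaller. *)
rewrite sr => /leq_trans/(_ sP); rewrite -[uphalf _]/(n.+2)./2 => h.
by have := odd_double_half n.+2; move: h; case: odd => /=; lia.
Qed.

Lemma msupp_card_ge (R : realType) (n : nat) (s : 'I_n.+1 -> R)
    (mu : {measure set R -> \bar R}) : strictly_positive_pos s ->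
  in_M_oo s mu -> (`I_(uphalf n.+1) #<= msupp mu)%card.
Proof.
move=> [a [b [_ [_ [_ spos]]]]] Mmu.
have [/finite_setP[k /[dup] muk /card_eq_uniq_seq[r [ur sr murE]]]|inf] :=
    pselect (finite_set (msupp mu)); last first.
  apply: (@card_le_trans _ _ _ [set: nat]); first exact: subset_card_le.
  exact/infiniteP.
rewrite (card_le_eqr muk) card_le_II leqNgt; apply/negP => km.
(* With [k < uphalf n.+1] atoms the square has degree [2 k], at most [n]. *)
pose P := nodal r * nodal r.
have sP : (size P <= n.+1)%N.
  rewrite size_monicM ?monic_nodal ?nodal_neq0// !size_nodal sr.
  have := odd_double_half n.+2; move: km; rewrite -[uphalf _]/(n.+2)./2.
  by case: odd => /=; lia.
have : 0 < sigma_s s P.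
  apply: spos => //; last by rewrite mulf_neq0 ?nodal_neq0.
  by move=> x _; rewrite hornerM -expr2 sqr_ge0.
(* [P] vanishes on the support, hence almost everywhere. *)
have [N [mN N0 suppN]] := negligible_setC_msupp mu.
rewrite -lte_fin -(integral_in_M_oo Mmu)// (_ : (\int[_]_x _)%E = 0%E) ?ltxx//.
rewrite -[RHS](integral0 mu setT); apply: ae_eq_integral => //.
- exact: emeasurable_poly.
- apply: (ae_eq_off mN N0) => x Nx.
  have xr : x \in r.
    have : msupp mu x by apply: contrapT => /suppN.
    by rewrite murE.
  by rewrite hornerM nodal_root// mul0r.
Qed.

Lemma in_M_oo_quadrature (R : realType) (n j : nat) (s : 'I_n.+1 -> R)
    (a b : R) (e : seq R) :
  0 < a -> a < b -> strictly_positive_on s a b -> n.+1 = (j.*2 + size e)%N ->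
  uniq e -> {in e, forall y, y = a \/ y = b} ->
  exists r (w : R -> R), [/\ uniq (e ++ r), size r = j,
    {in r, forall z, a < z < b}, {in e ++ r, forall x, 0 < w x} &
    in_M_oo s (atomic_measure (e ++ r) w)].
Proof.
move=> a0 ab [_ spos] nE ue eab.
have [r [w [ut sr rab w0 LE]]] :=
  quadrature (L := sigma_s s) ab spos nE ue eab.
exists r, w; split=> //; split.
  exists a, b; split=> //; split=> //.
  rewrite atomic_measureE big1_seq// => z /= zt.
  rewrite diracE memNset ?mule0//= in_itv /= => H; apply: H.
  by move: zt; rewrite mem_cat => /orP[/eab[]->|/rab/andP[? ?]];
    rewrite ?lexx ?ltW.
move=> k; rewrite integral_atomic; last exact: exprn_measurable.
rewrite -(sigma_sXn s k) LE ?size_polyXn//; congr EFin.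
(* The absolute value in [atomic_measure], which lets any [w] define a measure, disappears on
   positive weights. *)
by apply: eq_big_seq => x xt; rewrite hornerXn gtr0_norm ?w0.
Qed.

Lemma strictly_positive_ind (R : realType) (n : nat) (s : 'I_n.+1 -> R) :
  strictly_positive_pos s -> ind_pos_eq s (uphalf n.+1).
Proof.
move=> /[dup] spp [a [b [a0 [ab spos]]]]; split; last first.
  by move=> mu; exact: msupp_card_ge.
(* Gauss rule for odd [n], Radau rule at [a] for even [n]: both have the minimal number of nodes. *)
have [j [e [nE ue eab se]]] : exists j (e : seq R),
    [/\ n.+1 = (j.*2 + size e)%N, uniq e, {in e, forall y, y = a \/ y = b} &
      (size e + j = uphalf n.+1)%N].
  have := odd_double_half n; have := uphalf_half n.+1 => /=.
  case: (odd n) => /= -> nE.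
    by exists n.+1./2, [::]; split=> //=; move: nE; rewrite uphalf_half; lia.
  exists n./2, [:: a]; split=> //=; [lia| |lia].
  by move=> y; rewrite inE => /eqP; left.
have [r [w [ut sr rab w0 Mmu]]] := in_M_oo_quadrature a0 ab spos nE ue eab.
exists (atomic_measure (e ++ r) w); split=> //.
by rewrite msupp_atomic// -se -sr -size_cat; exact: card_eq_seq.
Qed.

Lemma atomic_measure_set1_gt0 (R : realType) (t : seq R) (w : R -> R) (a : R) :
  {in t, forall x, 0 < w x} ->
  (0 < atomic_measure t w [set a])%E = (a \in t).
Proof.
move=> w0; rewrite atomic_measureE; have [at_|at_] := boolP (a \in t).
  rewrite (big_rem a)//= lte_paddr//.
    by apply: sume_ge0 => z _; rewrite mule_ge0.
  by rewrite diracE mem_set// mule1 lte_fin normr_gt0 gt_eqF ?w0.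
rewrite big1_seq ?ltxx// => z /= zt; rewrite diracE memNset ?mule0//= => za.
by rewrite -za zt in at_.
Qed.

Lemma strictly_positive_indeterminate (R : realType) (n : nat)
    (s : 'I_n.+1 -> R) : strictly_positive_pos s -> indeterminate_pos s.
Proof.
move=> [a [b [a0 [ab spos]]]].
have [j [e [k [f [nE mE [ue uf] [eab fab] [ae af]]]]]] :
    exists j (e : seq R) k (f : seq R),
    [/\ n.+1 = (j.*2 + size e)%N, n.+1 = (k.*2 + size f)%N, uniq e /\ uniq f,
      {in e, forall y, y = a \/ y = b} /\ {in f, forall y, y = a \/ y = b} &
      a \in e /\ a \notin f].
  have ba : (b == a) = false by rewrite gt_eqF.
  have := odd_double_half n; case: (odd n) => /= nE.
    exists n./2, [:: a; b], (n./2).+1, [::]; split=> //=; try lia.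
    - by rewrite inE eq_sym ba.
    - by split=> // y; rewrite !inE => /orP[]/eqP; [left|right].
    - by rewrite mem_head.
  exists n./2, [:: a], n./2, [:: b]; split=> //=; try lia.
  - by split=> y; rewrite inE => /eqP; [left|right].
  - by rewrite !inE eqxx eq_sym ba.
have [r [w [_ _ _ w0 Mmu]]] := in_M_oo_quadrature a0 ab spos nE ue eab.
have [q [v [_ _ qab v0 Mnu]]] := in_M_oo_quadrature a0 ab spos mE uf fab.
exists (atomic_measure (e ++ r) w), (atomic_measure (f ++ q) v).
(* The mass at [a] separates them: the free nodes [q] of the second rule lie strictly between [a]
   and [b]. *)
do 2 split=> //; exists [set a]; split; first exact: measurable_set1.
move=> E; have := atomic_measure_set1_gt0 a w0.
rewrite E (atomic_measure_set1_gt0 a v0) !mem_cat ae (negbTE af) /=.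
by move=> /qab; rewrite ltxx.
Qed.

Theorem theorem4p6 (R : realType) (n : nat) (s : 'I_n.+1 -> R) :
  (forall k, 0 <= s k) ->
  positive_pos s ->
  (strictly_positive_pos s <-> ind_pos_eq s (uphalf n.+1)) /\
  (ind_pos_eq s (uphalf n.+1) <-> indeterminate_pos s).
Proof.
move=> _ _; split; split.
- exact: strictly_positive_ind.
- exact: ind_strictly_positive.
- by move=> /ind_strictly_positive; exact: strictly_positive_indeterminate.
- by move=> /indeterminate_strictly_positive; exact: strictly_positive_ind.
Qed.
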